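(* There exist a countable group $G$ and an ergodic measure-preserving action of $G$ on a Lebesgue space $(X,\mu)$ which is essentially free (and thus not totally non-free) such that the associated character $\chi(g)=\mu(\mathrm{Fix}(g))$, $g\in G$, is indecomposable.
   Context: A Lebesgue space is a standard probability space. $\mathrm{Fix}(g)=\{x\in X:gx=x\}$. The action is essentially free if $\mu(\mathrm{Fix}(g))=0$ for all $g\ne e$. A measure-preserving action of a countable group $G$ on a Lebesgue space $(X,\Sigma,\mu)$ is totally non-free if the collection of sets $\mathrm{Fix}(g)$, $g\in G$, together with the sets of zero measure generates the sigma-algebra $\Sigma$. A character on $G$ is a function $\chi:G\to\mathbb C$ with $\chi(g_1g_2)=\chi(g_2g_1)$ for all $g_1,g_2$, positive semi-definite matrices $(\chi(g_ig_j^{-1}))_{i,j=1}^n$ for all $n\ge1$ and $g_1,\dots,g_n\in G$, and $\chi(e)=1$; it is indecomposable if it cannot be written as $\alpha\chi_1+(1-\alpha)\chi_2$ with $0<\alpha<1$ and $\chi_1,\chi_2$ distinct characters. *)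

(* Defs.v *)
From HB Require Import structures.
From mathcomp Require Import all_boot all_order all_algebra.
From mathcomp Require Import complex.
From mathcomp Require Import all_classical all_reals all_analysis.

Set Implicit Arguments.
Unset Strict Implicit.
Unset Printing Implicit Defensive.

Import Order.TTheory GRing.Theory Num.Theory.
Import numFieldNormedType.Exports.

Local Open Scope classical_set_scope.
Local Open Scope ring_scope.

Section LebesgueSpace.
Context {R : realType}.

Definition polish (Y : completePseudoMetricType R) : Prop :=
  hausdorff_space Y /\ exists2 D : set Y, countable D & dense D.

(* (X, measurable, mu) is the completion of a Borel probability measure on a
   Polish space: f transports a Polish topology to X, and the measurable sets
   are exactly those squeezed between two Borel sets differing by a null set.
   Taking B1 = B2 shows that f is Borel measurable; as the diagonal of Y * Y is
   Borel, Fix(g) is measurable for every measurable action. *)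
Definition lebesgue_space d (X : measurableType d) (mu : probability X R)
    : Prop :=
  exists (Y : completePseudoMetricType R) (f : X -> Y),
    [/\ polish Y, bijective f &
      forall A : set X, measurable A <->
        exists B1 B2 : set Y,
          [/\ <<s open >> B1, <<s open >> B2,
              f @^-1` B1 `<=` A, A `<=` f @^-1` B2 &
              mu (f @^-1` B2 `\` f @^-1` B1) = 0%E]].

End LebesgueSpace.

Section Actions.
Context {R : realType} {G : groupType} {d : measure_display}
  {X : measurableType d}.
Variables (mu : probability X R) (act : G -> X -> X).

Definition is_action : Prop :=
  (forall x, act 1%g x = x) /\
  (forall g h x, act (g * h)%g x = act g (act h x)).

Definition measure_preserving_action : Prop :=
  is_action /\
  forall g, measurable_fun setT (act g) /\
    forall A, measurable A -> mu (act g @^-1` A) = mu A.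

Definition ergodic_action : Prop :=
  forall A, measurable A -> (forall g, act g @^-1` A = A) ->
    mu A = 0%E \/ mu A = 1%E.

Definition Fix (g : G) : set X := [set x | act g x = x].

Definition essentially_free : Prop := forall g, g <> 1%g -> mu (Fix g) = 0%E.

Definition totally_non_free : Prop :=
  <<s range Fix `|` [set N | measurable N /\ mu N = 0%E] >> =
  (measurable : set (set X)).

Definition fix_character (g : G) : R[i] := (fine (mu (Fix g)))%:C%C.

End Actions.

Section Characters.
Context {R : realType}.

(* On R[i], 0 <= z means that z is real and nonnegative, so this condition
   forces M to be Hermitian. *)
Definition pos_semidef n (M : 'M[R[i]]_n) : Prop :=
  forall v : 'rV[R[i]]_n,
    0 <= \sum_(i < n) \sum_(j < n) v 0 i * M i j * Num.conj (v 0 j).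

Definition is_character (G : groupType) (chi : G -> R[i]) : Prop :=
  [/\ forall g h, chi (g * h)%g = chi (h * g)%g,
      forall (n : nat) (g : 'I_n -> G), (0 < n)%N ->
        pos_semidef (\matrix_(i, j) chi (g i * (g j)^-1)%g) &
      chi 1%g = 1].

Definition indecomposable (G : groupType) (chi : G -> R[i]) : Prop :=
  is_character chi /\
  ~ exists (alpha : R) (chi1 chi2 : G -> R[i]),
      [/\ 0 < alpha < 1, is_character chi1, is_character chi2, chi1 <> chi2 &
        forall g, chi g = alpha%:C%C * chi1 g + (1 - alpha)%:C%C * chi2 g].

End Characters.

(* Main.v *)
Require Import Defs.
From HB Require Import structures.
From mathcomp Require Import all_boot all_order all_algebra.
From mathcomp Require Import complex.
From mathcomp Require Import finmap ring lra zify.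
From mathcomp Require Import all_classical all_reals all_analysis.

Set Implicit Arguments.
Unset Strict Implicit.
Unset Printing Implicit Defensive.

(** The regular character delta_1 of a countable group G is the character of any
    essentially free action of G, since mu (Fix g) = 0 for g <> 1; and it is
    indecomposable as soon as all nontrivial conjugacy classes of G are infinite
    (icc_indecomposable).  Indeed a character that is a summand of delta_1 is
    dominated by it as a positive definite function, hence square summable on G,
    while it is constant on conjugacy classes; so it vanishes outside 1.  It
    remains to produce one essentially free ergodic action of such a group on a
    nonatomic Lebesgue space.

    The group is the lamplighter group, the wreath product of Z/2 by Z.  It acts on
    the compact group {0,1}^Z of configurations, with its fair coin measure mu: Z
    acts by shifts, and the finite configurations act by addition, that is, by
    flipping finitely many coordinates.  Everything about mu follows from one
    uniqueness property: a finite Borel measure that is invariant under all flips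
    of one coordinate is determined by its total mass (flip_invariant_unique).
    - The action permutes the coordinate flips by conjugation, so it maps mu to a
      flip-invariant probability measure, which is mu (coin_preserved).
    - If A is invariant under flips, the restriction of mu to A is flip-invariant,
      so it is mu A times mu; hence mu A = mu A * mu A, and the action is ergodic
      (coin_zero_one).
    - Two elements with the same Z-component that fix a common point are equal
      (lamp_act_separated), and conjugation preserves the Z-component.  Hence the
      infinitely many conjugates of any g <> 1 have disjoint fixed point sets,
      which all have the same measure: it is 0 (icc_essentially_free).
    An essentially free action is not totally non-free here, because its Fix sets
    and the null sets generate only sets of measure 0 or 1, and a half space
    x 0 = 1 has measure 1/2.

    The measure mu is realized as the law of the binary digits of a uniform point
    of [0, 1), and the Lebesgue space as the Caratheodory completion of the Borel
    sets of the Polish space {0,1}^Z. *)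

Import Order.TTheory GRing.Theory Num.Theory.
Import numFieldNormedType.Exports.

Local Open Scope classical_set_scope.
Local Open Scope ring_scope.

(** * Indecomposability of the regular character *)

(** Conjugators are recorded rather than conjugates, because the condition is
    used to carry values of characters and measures of fixed point sets from g to
    its conjugates. *)
Definition icc (G : groupType) :=
  forall g : G, g <> 1%g -> exists h : nat -> G, injective (fun k => (g ^ h k)%g).

Section Characters.
Context {R : realType} {G : groupType}.
Implicit Types (chi : G -> R[i]) (g h : G).

Lemma character_conjg chi g h : is_character chi -> chi (g ^ h)%g = chi g.
Proof. by case=> chiC _ _; rewrite /conjg chiC -mulgA mulgV mulg1. Qed.

Lemma character_psd_sum chi (s : seq G) (a : G -> R[i]) : is_character chi ->
  0 <= \sum_(g <- s) \sum_(h <- s) a g * chi (g * h^-1)%g * Num.conj (a h).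
Proof.
case=> _ + _; case: s => [|g0 s]; first by rewrite big_nil.
set t := g0 :: s => /(_ (size t) (fun i => nth 1%g t i) isT).
move=> /(_ (\row_i a (nth 1%g t i))) /le_trans; apply.
rewrite [leRHS](big_nth 1%g) big_mkord le_eqVlt; apply/orP; left; apply/eqP.
apply: eq_bigr => i _; rewrite [RHS](big_nth 1%g) big_mkord.
by apply: eq_bigr => j _; rewrite !mxE.
Qed.

(** The quadratic form of chi on the pair (1, g) is real for the coefficients
    (1, 1) and (1, i); these two conditions force chi (g^-1) to be the conjugate
    of chi g. *)
Lemma character_inv chi g : is_character chi -> chi (g^-1)%g = Num.conj (chi g).
Proof.
move=> chiP; have [_ _ chi1] := chiP.
have [->|g1] := eqVneq g 1%g; first by rewrite invg1 chi1 rmorph1.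
have psd (c : R[i]) : 1 + chi (g^-1)%g * Num.conj c +
    (c * chi g + c * Num.conj c) \is Num.real.
  apply: ger0_real.
  have /= := character_psd_sum [:: 1%g; g] (fun h => if h == 1%g then 1 else c) chiP.
  rewrite !big_cons !big_nil !addr0 eqxx (negPf g1) mulgV invg1 mulg1 mul1g.
  by rewrite mulgV !chi1 rmorph1 !mulr1 !mul1r.
have cross (c : R[i]) : chi (g^-1)%g * Num.conj c + c * chi g \is Num.real.
  rewrite (_ : _ + _ = 1 + chi (g^-1)%g * Num.conj c +
      (c * chi g + c * Num.conj c) - (1 + c * Num.conj c)); last by ring.
  by rewrite rpredB ?psd// ger0_real// addr_ge0 ?ler01 ?mul_conjC_ge0.
have /CrealP := cross 1; rewrite rmorph1 mulr1 mul1r rmorphD/= => r1.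
have /CrealP := cross 'i; rewrite conjCi mulrN mulrC addrC -mulrBr.
rewrite rmorphM rmorphB/= conjCi mulNr -mulrN => /(mulfI (neq0Ci _)) r2.
have two : (2%:R : R[i]) != 0 by rewrite pnatr_eq0.
apply: (mulfI two).
rewrite [RHS](_ : _ = Num.conj (chi g^-1%g) + Num.conj (chi g) -
  - (Num.conj (chi g) - Num.conj (chi g^-1%g))); last by ring.
by rewrite r1 r2; ring.
Qed.

Definition delta_character (g : G) : R[i] := (g == 1%g)%:R.

(** The associated matrix is the indicator of the relation g i = g j, so its
    quadratic form is the sum, over the values k of g, of the squared modulus of
    the sum of the coefficients whose index is sent to k. *)
Lemma delta_characterP : is_character delta_character.
Proof.
split.
- move=> g h; congr (nat_of_bool _)%:R; apply/eqP/eqP.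
    by move=> /(congr1 (fun x => g^-1 * x * g)%g); rewrite !mulgA mulVg mul1g mulg1 mulVg.
  by move=> /(congr1 (fun x => h^-1 * x * h)%g); rewrite !mulgA mulVg mul1g mulg1 mulVg.
- move=> n g _ v.
  pose w k := \sum_(i | g i == k) v 0 i.
  rewrite [leRHS](_ : _ = \sum_(k <- undup (codom g)) w k * Num.conj (w k)).
    by apply: sumr_ge0 => k _; rewrite mul_conjC_ge0.
  transitivity (\sum_i \sum_(j | g j == g i) v 0 i * Num.conj (v 0 j)).
    apply: eq_bigr => i _; rewrite [RHS]big_mkcond; apply: eq_bigr => j _.
    rewrite mxE /delta_character divg_eq1 eq_sym; case: eqP => _.
      by rewrite mulr1.
    by rewrite mulr0 mul0r.
  transitivity (\sum_i v 0 i * Num.conj (w (g i))).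
    by apply: eq_bigr => i _; rewrite -mulr_sumr rmorph_sum.
  under [RHS]eq_bigr do rewrite /w mulr_suml -/(w _).
  rewrite [RHS](exchange_big_dep xpredT)//=; apply: eq_bigr => i _.
  rewrite -big_filter (_ : seq.filter _ _ = [:: g i]) ?big_seq1//.
  rewrite (@eq_filter _ _ (pred1 (g i))); last by move=> k; rewrite /= eq_sym.
  by rewrite filter_pred1_uniq ?undup_uniq// mem_undup codom_f.
- by rewrite /delta_character eqxx.
Qed.

(** A summand chi1 of the regular character is dominated by it, hence square
    summable; being constant on an infinite conjugacy class, it vanishes there.
    Concretely, let c = chi1 g, let x_1, ..., x_n be distinct conjugates of g,
    and let S be the sum of the chi1 (x_i / x_j).  Positivity of chi2 at
    (1, ..., 1) gives a S <= n.  Positivity of chi1 at 1, x_1, ..., x_n with the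
    coefficients 1, t, ..., t, where t = - a times the conjugate of c, gives
    0 <= 1 - 2 n a |c|^2 + a^2 |c|^2 S.  Together, n a |c|^2 <= 1 for all n. *)
Lemma icc_summand0 (a : R) chi1 chi2 g : icc G -> 0 < a < 1 ->
  is_character chi1 -> is_character chi2 ->
  (forall g, delta_character g = a%:C%C * chi1 g + (1 - a)%:C%C * chi2 g) ->
  g <> 1%g -> chi1 g = 0.
Proof.
move=> iccG /andP[a0 a1] chi1P chi2P deltaE gn1.
have [_ _ chi11] := chi1P.
have [h hinj] := iccG _ gn1.
pose s n := [seq (g ^ h k)%g | k <- iota 0 n].
have sn1 n k : k \in s n -> k != 1%g.
  by move=> /mapP[j _ ->]; rewrite conjg_eq1; apply/eqP.
have us n : uniq (s n) by rewrite map_inj_uniq ?iota_uniq.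
pose c := chi1 g; pose A := a%:C%C.
pose S n := \sum_(x <- s n) \sum_(y <- s n) chi1 (x * y^-1)%g.
have A0 : 0 <= A by rewrite /A ler0c ltW.
have AS n : A * S n <= n%:R.
  have := character_psd_sum (s n) (fun=> 1) chi2P.
  under eq_bigr do under eq_bigr do rewrite rmorph1 mulr1 mul1r.
  set S2 := (X in 0 <= X) => S2_ge0.
  suff -> : n%:R = A * S n + (1 - a)%:C%C * S2.
    by rewrite lerDl mulr_ge0// ler0c subr_ge0 ltW.
  rewrite -[in LHS](size_iota 0 n) -(size_map (fun k => (g ^ h k)%g)) -/(s n).
  rewrite -sum1_size natr_sum /S2 !mulr_sumr -big_split/=.
  apply: eq_big_seq => x xs; rewrite !mulr_sumr -big_split/=.
  under eq_bigr do rewrite -deltaE /delta_character divg_eq1.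
  by rewrite (bigD1_seq x)//= eqxx big1 ?addr0// => y /negPf; rewrite eq_sym => ->.
have main n : n%:R * (A * (c * Num.conj c)) <= 1.
  pose t := - (A * Num.conj c); pose v x := if x == 1%g :> G then 1 else t.
  have := character_psd_sum (1%g :: s n) v chi1P.
  have v1 : v 1%g = 1 by rewrite /v eqxx.
  have vs x : x \in s n -> v x = t by move=> /sn1/negPf xn1; rewrite /v xn1.
  have chis x : x \in s n -> chi1 x = c.
    by move=> /mapP[k _ ->]; rewrite character_conjg.
  have sum_const (z : R[i]) : \sum_(x <- s n) z = n%:R * z.
    by rewrite big_const_seq count_predT size_map size_iota iter_addr addr0 mulr_natl.
  have ct : Num.conj t = - (A * c) by rewrite /t rmorphN rmorphM /= conjCK geC0_conj.
  rewrite big_cons [X in X + _]big_cons v1 divgg chi11 rmorph1 !mul1r.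
  rewrite (eq_big_seq (fun=> - (A * (c * Num.conj c)))); last first.
    move=> y ys; rewrite vs// ct mul1r mul1g character_inv// chis//.
    by rewrite mulrN mulrCA mulrA (mulrC c) -mulrA.
  rewrite [X in _ + X](eq_big_seq (fun x => - (A * (c * Num.conj c)) +
      A * A * (c * Num.conj c) * \sum_(y <- s n) chi1 (x / y)%g)); last first.
    move=> x xs; rewrite big_cons v1 vs// rmorph1 mulr1 invg1 mulg1 chis//.
    congr (_ + _); first by rewrite /t mulNr -mulrA (mulrC c).
    rewrite mulr_sumr; apply: eq_big_seq => y ys; rewrite vs// ct /t.
    by rewrite mulNr mulrNN; ring.
  rewrite big_split/= !sum_const -mulr_sumr -/(S n).
  have := ler_wpM2l (mulr_ge0 A0 (mul_conjC_ge0 c)) (AS n).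
  set K := c * Num.conj c => h1 h2.
  rewrite -subr_ge0; apply: le_trans h2 _; rewrite -subr_ge0.
  rewrite [leRHS](_ : _ = A * K * n%:R - A * K * (A * S n)) ?subr_ge0//; ring.
apply/eqP; rewrite -[_ == 0]/(c == 0); apply/negPn/negP => cn0.
have : 0 < A * (c * Num.conj c).
  by apply: mulr_gt0; [rewrite /A ltcR | rewrite mul_conjC_gt0].
(* A positive element of R[i] is real: compare real parts. *)
case: (A * _) main => x y main; rewrite ltcE/= => /andP[_ x0].
have := main (Num.truncn x^-1).+1.
rewrite lecE => /andP[_]; rewrite mulr_natl raddfMn/= -mulr_natl.
rewrite leNgt -ltr_pdivrMr// mul1r => /negP; apply.
exact: truncnS_gt.
Qed.

Lemma icc_indecomposable : icc G -> indecomposable delta_character.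
Proof.
move=> iccG; split; first exact: delta_characterP.
move=> [a [chi1 [chi2 [a01 chi1P chi2P neq deltaE]]]]; apply: neq.
have [[_ _ e1] [_ _ e2]] := (chi1P, chi2P).
apply/funext => g; have [->|/eqP gn1] := eqVneq g 1%g; first by rewrite e1 e2.
rewrite (icc_summand0 iccG a01 chi1P chi2P deltaE gn1).
apply/esym/(@icc_summand0 (1 - a) _ chi1) => //.
  by move: a01; rewrite subr_gt0 ltrBlDr ltrDl andbC.
by move=> k; rewrite deltaE addrC opprB addrCA subrr addr0.
Qed.

End Characters.

(** * Completion of a probability measure *)

Section Completion.
Context {R : realType} {d : measure_display} {T : measurableType d}.
Variable P : probability T R.

Local Notation completed := (caratheodory_type (P^*)%mu).
Local Notation completion := (@completed_measure_extension _ _ _ P).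

Lemma le_completion (A B : set completed) :
  A `<=` B -> (completion A <= completion B)%E.
Proof. by move=> AB; apply: (@le_mu_ext _ T R P). Qed.

Lemma completionE (A : set T) : measurable A -> completion A = P A.
Proof. exact: measurable_mu_extE. Qed.

Lemma measurable_completed (A : set T) : measurable A -> measurable (A : set completed).
Proof. exact: caratheodory_measurable_mu_ext. Qed.

Let completion_setT : completion setT = 1%E.
Proof. by rewrite completionE// probability_setT. Qed.

HB.instance Definition _ :=
  Measure_isProbability.Build _ _ _ completion completion_setT.

(** The outer measure is an infimum over countable covers; intersecting covers
    that are optimal up to 1 / (n + 1) attains it. *)
Lemma completion_hull (A : set completed) :
  exists B : set T, [/\ measurable B, A `<=` B & P B = completion A].
Proof.
have Afin : completion A \is a fin_num.
  rewrite ge0_fin_numE; last exact: mu_ext_ge0.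
  apply: le_lt_trans (ltry 1); rewrite -completion_setT; exact: le_mu_ext.
have cover (n : nat) : exists B : set T, [/\ measurable B, A `<=` B &
    (P B <= completion A + n.+1%:R^-1%:E)%E].
  have [|_ [F [mF AF] <-] PF] := @lb_ereal_inf_adherent R _ n.+1%:R^-1 _ Afin.
    by rewrite invr_gt0.
  exists (\bigcup_k F k); split => //; first exact: bigcupT_measurable.
  apply: le_trans (ltW PF).
  by apply: measure_sigma_subadditive => //; exact: bigcupT_measurable.
pose B n := projT1 (cid (cover n)).
have mB n : measurable (B n) by have [] := projT2 (cid (cover n)).
have AB n : A `<=` B n by have [] := projT2 (cid (cover n)).
have PB n : (P (B n) <= completion A + n.+1%:R^-1%:E)%E.
  by have [] := projT2 (cid (cover n)).
have mIB : measurable (\bigcap_n B n) by exact: bigcapT_measurable.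
have AIB : A `<=` \bigcap_n B n by exact: sub_bigcap.
exists (\bigcap_n B n); split => //.
apply/eqP; rewrite eq_le -{2}completionE// le_mu_ext// andbT.
apply/lee_addgt0Pr => e e0.
apply: (@le_trans _ _ (P (B (Num.truncn e^-1)))).
  by apply: le_measure; rewrite ?inE//; exact: bigcap_inf.
apply: le_trans (PB _) _; rewrite leeD2l// lee_fin.
by rewrite invf_ple ?posrE ?ltr0n//; exact/ltW/truncnS_gt.
Qed.

(** This is the form in which a Lebesgue space is specified.  The inner
    approximation of A is the complement of a hull of the complement of A; that
    the gap is null uses that A splits its hulls additively. *)
Lemma completion_measurableP (A : set completed) : measurable A <->
  exists B1 B2 : set T, [/\ measurable B1, measurable B2, B1 `<=` A, A `<=` B2 &
    completion (B2 `\` B1) = 0%E].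
Proof.
split=> [mA|[B1 [B2 [mB1 mB2 B1A AB2 null]]]].
  have [B2 [mB2 AB2 PB2]] := completion_hull A.
  have [C [mC AC PC]] := completion_hull (~` A).
  exists (~` C), B2; split => //; first exact: measurableC.
    by rewrite -[A]setCK; exact: subsetC.
  have -> : B2 `\` ~` C = B2 `&` C by rewrite setDE setCK.
  have hull0 (E : set completed) (B : set T) : measurable E -> measurable B ->
      E `<=` B -> P B = completion E -> completion (B `\` E) = 0%E.
    move=> mE mB EB PB; have mB' := measurable_completed mB.
    have BP : completion B = P B := completionE mB.
    have Bfin : completion B \is a fin_num by rewrite BP fin_num_measure.
    rewrite measureD//; last by rewrite -ge0_fin_numE//; exact: mu_ext_ge0.
    by rewrite setIidr// [X in (X - _)%E]BP PB subee// -PB -BP.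
  apply/eqP; rewrite -measure_le0.
  apply: (@le_trans _ _ (completion ((B2 `\` A) `|` (C `\` ~` A)))).
    apply: le_mu_ext => x [B2x Cx]; have [Ax|nAx] := pselect (A x); last by left.
    by right; split => // /(_ Ax).
  have mD1 : measurable (B2 `\` A : set completed).
    exact: measurableD (measurable_completed mB2) mA.
  have mD2 : measurable (C `\` ~` A : set completed).
    exact: measurableD (measurable_completed mC) (measurableC mA).
  apply: le_trans (measureU2 _ mD1 mD2) _.
  rewrite [X in (X + _)%E](hull0 _ _ mA mB2 AB2 PB2) add0e.
  by rewrite [X in (X <= _)%E](hull0 _ _ (measurableC mA) mC AC PC).
have -> : A = (B1 : set completed) `|` (A `\` B1).
  by rewrite setDUK.
apply: measurableU; first exact: measurable_completed.
apply: (@measure_is_complete_caratheodory R T (P^*)%mu).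
exists (B2 `\` B1); split => //; last exact: setSD.
exact/measurable_completed/measurableD.
Qed.

Lemma completion_squeeze (A : set completed) (B1 B2 : set T) :
  measurable B1 -> measurable B2 -> B1 `<=` A -> A `<=` B2 ->
  completion (B2 `\` B1) = 0%E -> completion A = P B1.
Proof.
move=> mB1 mB2 B1A AB2 null; apply/eqP; rewrite eq_le -completionE//.
rewrite [X in _ && X]le_mu_ext// andbT.
apply: le_trans (le_completion AB2) _.
rewrite -(setDUK (subset_trans B1A AB2)).
apply: le_trans (measureU2 _ (measurable_completed mB1) _) _.
  exact/measurable_completed/measurableD.
by rewrite [X in (_ + X)%E]null adde0.
Qed.

(** Preimages of a squeeze between two sets of the base sigma-algebra are again
    such a squeeze, so a transformation has only to be examined on that
    sigma-algebra. *)
Lemma completed_measurable_fun (f : T -> T) :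
  measurable_fun setT f -> (forall A, measurable A -> P (f @^-1` A) = P A) ->
  measurable_fun setT (f : completed -> completed) /\
  forall A : set completed, measurable A -> completion (f @^-1` A) = completion A.
Proof.
move=> mf Pf.
have mf' (A : set T) : measurable A -> measurable (f @^-1` A).
  by move=> mA; rewrite -[X in measurable X]setTI; exact: mf.
have fnull (B1 B2 : set T) : measurable B1 -> measurable B2 ->
    completion (B2 `\` B1) = 0%E -> completion (f @^-1` B2 `\` f @^-1` B1) = 0%E.
  move=> mB1 mB2; have mB := measurableD mB2 mB1.
  rewrite -[f @^-1` B2 `\` _]/(f @^-1` (B2 `\` B1)).
  by rewrite (completionE mB) (completionE (mf' _ mB)) Pf.
split=> [_ A|A] /completion_measurableP[B1 [B2 [mB1 mB2 B1A AB2 null]]].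
  rewrite setTI; apply/completion_measurableP; exists (f @^-1` B1), (f @^-1` B2).
  by split; [exact: mf'|exact: mf'|exact: preimage_subset|
             exact: preimage_subset|exact: fnull].
rewrite (completion_squeeze mB1 mB2 B1A AB2 null) -Pf//.
apply: completion_squeeze (mf' _ mB1) (mf' _ mB2) _ _ (fnull _ _ mB1 mB2 null);
  exact: preimage_subset.
Qed.

End Completion.

(** * The space of configurations *)

Definition config (I : countType) : Type := prod_topology (fun _ : I => bool).

HB.instance Definition _ (I : countType) := Uniform.on (config I).
HB.instance Definition _ (I : countType) := Pointed.on (config I).
HB.instance Definition _ (R : realType) (I : countType) :=
  PseudoMetric.copy (config I)
    (prod_topology (fun _ : I => (bool : pseudoMetricType R))).

Section ConfigTopology.
Context {I : countType}.
Implicit Types (x y : config I) (n : nat).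

Lemma config_compact : compact [set: config I].
Proof.
have := @tychonoff _ (fun _ : I => _) _ (fun=> bool_compact).
by congr (compact _); rewrite eqEsubset.
Qed.

Lemma config_hausdorff : hausdorff_space (config I).
Proof. by apply: hausdorff_product => ?; exact: discrete_hausdorff. Qed.

Lemma config_complete (F : set_system (config I)) :
  ProperFilter F -> cauchy F -> cvg F.
Proof.
by move=> FF Fc; exact: compact_cauchy_cvg Fc filterT config_compact.
Qed.

HB.instance Definition _ := Uniform_isComplete.Build (config I) config_complete.

(** Coordinates are listed in the order of their codes, so that the cylinders of
    depth n form a partition that refines the one of depth n - 1 by at most one
    new coordinate.  Some depths may code no coordinate. *)
Definition cylinder n x : set (config I) :=
  [set y | forall i, (choice.pickle i < n)%N -> y i = x i].

Lemma open_coord (i : I) (b : bool) : open [set x : config I | x i = b].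
Proof.
rewrite (_ : mkset _ = proj i @^-1` [set b]) //.
by apply: open_comp (discrete_open _) => x _; exact: proj_continuous.
Qed.

Lemma cylinderS n x : cylinder n.+1 x = cylinder n x `&`
  (if pickle_inv n is Some i then [set y : config I | y (i : I) = x i] else setT).
Proof.
apply/seteqP; split=> y.
  move=> yx; split=> [i /ltnW|]; first exact: yx.
  by case: pickle_inv (@pickle_invK I n) => //= i pin; apply: yx; rewrite pin.
move=> [yx yn] i; rewrite ltnS leq_eqVlt => /orP[/eqP pin|]; last exact: yx.
by move: yn; rewrite -pin pickleK_inv.
Qed.

Lemma cylinder_open n x : open (cylinder n x).
Proof.
elim: n => [|n ih].
  suff -> : cylinder 0 x = setT by exact: openT.
  by apply/seteqP; split.
rewrite cylinderS; apply: openI => //.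
by case: pickle_inv => [i|]; [exact: open_coord|exact: openT].
Qed.

(** The cylinders around x generate a filter along which every coordinate
    converges to that of x, hence one that converges to x. *)
Lemma nbhs_cylinder x (U : set (config I)) :
  nbhs x U -> exists n, cylinder n x `<=` U.
Proof.
pose F : set_system (config I) := filter_from setT (fun n => cylinder n x).
have FF : Filter F.
  apply: filter_from_filter; first by exists 0%N.
  move=> m n _ _; exists (maxn m n) => // y yx.
  by split=> i im; apply: yx; rewrite leq_max im ?orbT.
suff Fx : F --> x by move=> /Fx[n _ nU]; exists n.
apply/cvg_sup => i A; rewrite nbhsE => -[B [[C oC <-] Cx] BA].
by exists (choice.pickle i).+1 => // y yx; apply: BA; rewrite /= yx.
Qed.

Definition point_of_seq (t : seq bool) : config I :=
  fun i => nth false t (choice.pickle i).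

(** There are countably many cylinders: each one has a centre given by a finite
    word. *)
Lemma cylinder_point_of_seq n x :
  exists t, cylinder n (point_of_seq t) = cylinder n x.
Proof.
exists (mkseq (fun k => oapp x false (pickle_inv k)) n).
by apply/seteqP; split=> y yx i ipn; rewrite yx// /point_of_seq
  nth_mkseq// pickleK_inv.
Qed.

Lemma config_dense : dense (range point_of_seq).
Proof.
move=> U [x Ux] oU; have [n nU] : exists n, cylinder n x `<=` U.
  by apply: nbhs_cylinder; exact: open_nbhs_nbhs.
have [t tx] := cylinder_point_of_seq n x.
by exists (point_of_seq t); split; [apply: nU; rewrite -tx|exists t].
Qed.

End ConfigTopology.

Lemma config_polish (R : realType) (I : countType) :
  @polish R (config I).
Proof.
split; first exact: config_hausdorff.
exists (range point_of_seq); last exact: config_dense.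
exact: card_le_trans (card_image_le _ _) (countableP _).
Qed.

Section ConfigBorel.
Context {I : countType}.

(** The empty set is added to make the family stable under intersection. *)
Definition cylinders : set (set (config I)) :=
  [set C | C = set0 \/ exists n x, C = cylinder n x].

Lemma setI_closed_cylinders : setI_closed cylinders.
Proof.
move=> A B [->|[m [x ->]]]; first by move=> _; left; rewrite set0I.
move=> [->|[n [y ->]]]; first by left; rewrite setI0.
wlog mn : m n x y / (m <= n)%N.
  by move=> h; have [/h|/ltnW/h] := leqP m n; [exact|rewrite setIC; exact].
(* Two cylinders are disjoint or nested. *)
have [[z [zx zy]]|/nonemptyPn ->] :=
  pselect (cylinder m x `&` cylinder n y !=set0); last by left.
right; exists n, y; apply/setIidPr => w wy i im.
by rewrite wy ?(leq_trans im)// -zx// zy// (leq_trans im).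
Qed.

Lemma open_sigma_cylinders : <<s (@open (config I)) >> = <<s cylinders >>.
Proof.
apply/seteqP; split; apply: smallest_sub; try exact: smallest_sigma_algebra.
- move=> U oU.
  pose C (nt : nat * seq bool) : set (config I) :=
    cylinder nt.1 (point_of_seq nt.2).
  have -> : U = \bigcup_nt (if `[< C nt `<=` U >] then C nt else set0).
    apply/seteqP; split=> [x Ux|x [nt _]]; last by case: asboolP => // /[apply].
    have [n nU] : exists n, cylinder n x `<=` U.
      by apply: nbhs_cylinder; exact: open_nbhs_nbhs.
    have [t tx] := cylinder_point_of_seq n x.
    by exists (n, t) => //; rewrite /C/= tx; case: asboolP.
  apply: (@countable_bigcupT_measurable _ (g_sigma_algebraType cylinders)) => // nt.
  case: asboolP => _; last exact: measurable0.
  by apply: sub_sigma_algebra; right; exists nt.1, (point_of_seq nt.2).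
- move=> _ [->|[n [x ->]]]; apply: sub_sigma_algebra.
    exact: open0.
  exact: cylinder_open.
Qed.

End ConfigBorel.

(** * Borel measures invariant under flips *)

Definition borel_config (I : countType) : Type :=
  g_sigma_algebraType (@open (config I)).

HB.instance Definition _ (I : countType) := Measurable.on (borel_config I).

Section FlipInvariance.
Context {R : realType} {I : countType}.
Implicit Types (x y : config I) (n : nat) (i : I).

Lemma measurable_cylinder n x : measurable (cylinder n x : set (borel_config I)).
Proof. by apply: sub_sigma_algebra; exact: cylinder_open. Qed.

Lemma measurable_coord i b : measurable [set x : borel_config I | x i = b].
Proof. by apply: sub_sigma_algebra; exact: open_coord. Qed.

Lemma measurable_borel_config :
  @measurable _ (borel_config I) = <<s @cylinders I >>.
Proof. exact: open_sigma_cylinders. Qed.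

Lemma measurable_fun_config d (T : measurableType d) (f : T -> borel_config I) :
  (forall i, measurable [set t | f t i]) -> measurable_fun setT f.
Proof.
move=> mf; apply: (measurability _ measurable_borel_config).
move=> _ [_ [->|[n [x ->]]] <-]; rewrite setTI; first by rewrite preimage_set0.
elim: n => [|n ih].
  by rewrite (_ : _ @^-1` _ = setT)//; apply/seteqP; split.
rewrite cylinderS preimage_setI; apply: measurableI => //.
case: pickle_inv => [i|]; last by rewrite preimage_setT.
case: (x i); first exact: mf.
rewrite (_ : _ @^-1` _ = ~` [set t | f t i]); first exact: measurableC.
by apply/seteqP; split=> t /= /negP; case: (f t i).
Qed.

Definition flip i (x : borel_config I) : borel_config I := fun j => x j (+) (j == i).

Lemma flipK i : involutive (flip i).
Proof. by move=> x; apply/funext => j; rewrite /flip -addbA addbb addbF. Qed.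

Lemma measurable_flip i : measurable_fun setT (flip i).
Proof.
apply: measurable_fun_config => j.
rewrite (_ : mkset _ = [set x : borel_config I | x j = (j != i)]).
  exact: measurable_coord.
by apply/seteqP; split=> x; rewrite /flip/=; case: (x j); case: (j == i).
Qed.

HB.instance Definition _ i :=
  isMeasurableFun.Build _ _ _ _ (flip i) (measurable_flip i).

Definition flip_invariant (m : set (borel_config I) -> \bar R) :=
  forall i A, measurable A -> m (flip i @^-1` A) = m A.

Lemma flip_cylinder i n x : flip i @^-1` cylinder n x = cylinder n (flip i x).
Proof.
by apply/seteqP; split=> y yx j jn; have := yx j jn; rewrite /flip/=;
  case: (y j); case: (x j); case: (j == i).
Qed.

(** When the coordinate of code n exists, flipping it exchanges the two
    subcylinders of depth n.+1 of a cylinder of depth n. *)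
Lemma cylinder_half (m : {measure set (borel_config I) -> \bar R}) n x :
  flip_invariant m -> 
  m (cylinder n x) = (if @pickle_inv I n is Some _ then
     m (cylinder n.+1 x) + m (cylinder n.+1 x) else m (cylinder n.+1 x))%E.
Proof.
move=> mflip; case E: (pickle_inv n) => [i|]; last by rewrite cylinderS E setIT.
have pin : choice.pickle i = n by have := @pickle_invK I n; rewrite E.
rewrite -[X in _ = (X + _)%E](mflip i _ (measurable_cylinder n.+1 x)) flip_cylinder.
have flip_low : cylinder n (flip i x) = cylinder n x.
  apply/seteqP; split=> y yx j jn; rewrite yx// /flip;
  by case: eqP => [ji|_]; rewrite ?addbF//; move: jn; rewrite ji pin ltnn.
have flip_at : flip i x i = ~~ x i by rewrite /flip eqxx addbT.
rewrite -measureU; [|exact: measurable_cylinder|exact: measurable_cylinder|].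
  congr (m _); rewrite !cylinderS E flip_low flip_at -setIUr.
  rewrite (_ : _ `|` _ = setT) ?setIT//.
  by apply/seteqP; split=> // y _ /=; case: (y i); case: (x i); auto.
rewrite !cylinderS E flip_low flip_at; apply/seteqP; split=> // y [[_ /= ->]] [_ /=].
by case: (x i).
Qed.

Lemma cylinder_unique (m1 m2 : {measure set (borel_config I) -> \bar R}) :
  (m1 setT < +oo)%E -> (forall n x, m1 (cylinder n x) = m2 (cylinder n x)) ->
  forall A, measurable A -> m1 A = m2 A.
Proof.
move=> m1oo m12 A mA.
apply: (@measure_unique _ R (borel_config I) cylinders
  (fun=> cylinder 0 (fun=> false)) _ _ _ _ m1 m2) => //.
- exact: measurable_borel_config.
- exact: setI_closed_cylinders.
- by move=> _; right; exists 0%N, (fun=> false).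
- by apply/seteqP; split=> // x _; exists 0%N.
- by move=> _ [->|[n [x ->]]]; rewrite ?measure0.
- move=> _; apply: le_lt_trans m1oo; apply: le_measure; rewrite ?inE//.
  exact: measurable_cylinder.
Qed.

(** The Haar measure of the compact group of configurations is unique, and
    already invariance under its dense subgroup of finite configurations
    characterizes it: by induction on the depth, such a measure is determined on
    cylinders by its total mass. *)
Lemma flip_invariant_unique (m1 m2 : {measure set (borel_config I) -> \bar R}) :
  flip_invariant m1 -> flip_invariant m2 ->
  m1 setT = m2 setT -> (m1 setT < +oo)%E ->
  forall A, measurable A -> m1 A = m2 A.
Proof.
move=> flip1 flip2 m12T m1oo; apply: cylinder_unique => // n x.
elim: n => [|n ih].
  rewrite (_ : cylinder 0 x = setT)//; apply/seteqP; split; exact.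
have fin (m : {measure set (borel_config I) -> \bar R}) :
    (m setT < +oo)%E -> m (cylinder n.+1 x) \is a fin_num.
  move=> moo; rewrite ge0_fin_numE//; apply: le_lt_trans moo.
  by apply: le_measure; rewrite ?inE//; exact: measurable_cylinder.
move: ih; rewrite (cylinder_half n x flip1) (cylinder_half n x flip2).
case: pickle_inv => // _.
rewrite -(fineK (fin m1 m1oo)) -(fineK (fin m2 _)) -?m12T// -!EFinD => -[r12].
by congr EFin; lra.
Qed.

Lemma measurable_fixpoints (f : borel_config I -> borel_config I) :
  measurable_fun setT f -> measurable [set x | f x = x].
Proof.
move=> mf; pose E n : set (borel_config I) :=
  if pickle_inv n is Some i then [set x | f x (i : I) = x i] else setT.
rewrite (_ : mkset _ = \bigcap_n E n).
  apply: bigcapT_measurable => n; rewrite /E; case: pickle_inv => // i.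
  pose C b : set (borel_config I) := [set x | x i = b].
  have mC b : measurable (C b `&` f @^-1` C b).
    apply: measurableI; first exact: measurable_coord.
    by rewrite -[X in measurable X]setTI; apply: mf => //; exact: measurable_coord.
  rewrite (_ : mkset _ = (C true `&` f @^-1` C true) `|` (C false `&` f @^-1` C false)).
    exact: measurableU.
  apply/seteqP; split=> x /=; last by case=> -[-> ->].
  by rewrite /C/= => ->; case: (x i); [left|right].
apply/seteqP; split=> x /= => [fx n _|fx].
  by rewrite /E; case: pickle_inv => //= i; rewrite fx.
apply/funext => i; have := fx (choice.pickle i) Logic.I.
by rewrite /E pickleK_inv.
Qed.

End FlipInvariance.

(** * The fair coin measure *)

Section CoinMeasure.
Context {R : realType}.

Let T : measurableType _ := measurableTypeR R.

Let measurable_unit : measurable (`[0, 1[%classic : set T).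
Proof. exact: measurable_itv. Qed.

Definition unit_lebesgue : set T -> \bar R :=
  mrestr lebesgue_measure measurable_unit.

HB.instance Definition _ := Measure.on unit_lebesgue.

Let unit_lebesgue_setT : unit_lebesgue setT = 1%E.
Proof.
by rewrite /unit_lebesgue /mrestr setTI lebesgue_measure_itv/= lte_fin ltr01 sube0.
Qed.

HB.instance Definition _ := Measure_isProbability.Build _ _ _
  unit_lebesgue unit_lebesgue_setT.

Definition digits (t : T) : borel_config nat :=
  fun k => odd (Num.truncn (2 ^+ k.+1 * t)).

Lemma truncn_half (s : R) : 0 <= s -> Num.truncn s = (Num.truncn (2 * s))./2.
Proof.
move=> s0; apply: truncn_def.
have /truncn_itv : 0 <= 2 * s by rewrite mulr_ge0.
set M := Num.truncn _ => /andP[].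
have -> : M.+1%:R = M%:R + 1 :> R by rewrite -natr1.
have -> : M%:R = (odd M)%:R + 2 * (M./2)%:R :> R.
  by rewrite -[in LHS](odd_double_half M) natrD -muln2 natrM mulrC.
have : (0 <= ((odd M)%:R : R) <= 1)%R by case: odd; rewrite /= ?ler01 ?lexx.
by rewrite -natr1 => /andP[b0 b1] h1 h2; apply/andP; split; lra.
Qed.

(** The integer with binary digits x 0, ..., x n.-1, the first one being the
    most significant. *)
Fixpoint code n (x : config nat) : nat := 
  if n is m.+1 then (x m + (code m x).*2)%N else 0%N.

(** Prescribing the first n binary digits of t places t in one dyadic interval
    of length 2 ^- n. *)
Lemma digits_cylinder (n : nat) (x : config nat) (t : R) : 0 <= t < 1 ->
  cylinder n x (digits t) <-> Num.truncn (2 ^+ n * t) = code n x.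
Proof.
move=> /andP[t0 t1]; elim: n => [|n ih].
  split=> // _; rewrite expr0 mul1r /=; apply: truncn_def.
  by rewrite t0.
rewrite cylinderS (pickleK_inv n : @pickle_inv nat n = Some n) /=.
have half : Num.truncn (2 ^+ n * t) = (Num.truncn (2 ^+ n.+1 * t))./2.
  by rewrite truncn_half ?mulr_ge0 ?exprn_ge0// mulrA -exprS.
rewrite half in ih; split=> [[/ih ih1 <-]|e].
  by rewrite /digits -ih1 odd_double_half.
split; first by apply/ih; rewrite e half_bit_double.
by rewrite /digits e oddD odd_double addbF oddb.
Qed.

Lemma code_lt n x : (code n x < 2 ^ n)%N.
Proof.
elim: n => // n ih; rewrite /= expnS; case: (x n) => /=; lia.
Qed.

Lemma truncn_scale_itv n m (t : R) : 0 <= t ->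
  Num.truncn (2 ^+ n * t) = m <-> m%:R / 2 ^+ n <= t < m.+1%:R / 2 ^+ n.
Proof.
move=> t0; have p0 : (0 : R) < 2 ^+ n by rewrite exprn_gt0.
rewrite ler_pdivrMr// ltr_pdivlMr// ![t * _]mulrC -truncn_eq ?mulr_ge0 ?(ltW p0)//.
by split=> [->//|/eqP].
Qed.

Lemma measurable_digits : measurable_fun setT (digits : T -> borel_config nat).
Proof.
apply: measurable_fun_config => k.
rewrite (_ : mkset _ = \bigcup_(m in [set m | odd m])
    (`[m%:R / 2 ^+ k.+1, m.+1%:R / 2 ^+ k.+1[%classic : set R)).
  by apply: bigcup_measurable => m _; exact: measurable_itv.
apply/seteqP; split=> [t /= dt|t [m om]].
  exists (Num.truncn (2 ^+ k.+1 * t)); first exact: dt.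
  have t0 : 0 <= t.
    (* The truncation of a negative number is 0, which is even. *)
    rewrite leNgt; apply/negP => t0; move: dt; rewrite /digits.
    rewrite (_ : Num.truncn _ = 0%N)//; apply/eqP; rewrite -leqn0 truncn_le_nat.
    by rewrite (lt_trans _ ltr01)// pmulr_rlt0// exprn_gt0.
  by rewrite /= in_itv/=; apply/truncn_scale_itv.
rewrite /= in_itv/= => tm; rewrite /digits; move/truncn_scale_itv : (tm) => -> //.
by case/andP: tm => + _; apply: le_trans; rewrite divr_ge0// exprn_ge0.
Qed.

HB.instance Definition _ := isMeasurableFun.Build _ _ _ _ digits measurable_digits.

Lemma digits_law n x :
  distribution unit_lebesgue digits (cylinder n x) = ((2 ^+ n)^-1)%:E.
Proof.
rewrite [LHS](_ : _ = lebesgue_measure (digits @^-1` cylinder n x `&` `[0, 1[%classic))//.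
have p0 : (0 : R) < 2 ^+ n by rewrite exprn_gt0.
rewrite (_ : _ `&` _ =
    `[(code n x)%:R / 2 ^+ n, (code n x).+1%:R / 2 ^+ n[%classic).
  rewrite lebesgue_measure_itv/= lte_fin ltr_pM2r ?invr_gt0// ltr_nat ltnSn.
  by rewrite -EFinD -mulrBl -natr1 addrAC subrr add0r mul1r.
apply/seteqP; split=> t; rewrite /= !in_itv/=.
  move=> [tx t01]; apply/truncn_scale_itv; first by case/andP: t01.
  exact/digits_cylinder.
move=> tm; have t01 : 0 <= t < 1.
  case/andP: tm => h1 h2; apply/andP; split.
    by apply: le_trans h1; rewrite divr_ge0// ltW.
  apply: (lt_le_trans h2); rewrite ler_pdivrMr// mul1r -natrX ler_nat.
  exact: code_lt.
split=> //; apply/digits_cylinder => //; apply/truncn_scale_itv => //.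
by case/andP: t01.
Qed.

(** Flipping a coordinate permutes the cylinders of each depth, and these all
    have the same measure. *)
Lemma digits_flip_invariant : flip_invariant (distribution unit_lebesgue digits).
Proof.
move=> i A mA.
apply: (@cylinder_unique R nat
  (distribution (distribution unit_lebesgue digits) (flip i))
  (distribution unit_lebesgue digits)) => //.
  exact: le_lt_trans (probability_le1 _ measurableT) (ltry _).
move=> n x.
transitivity (distribution unit_lebesgue digits (cylinder n (flip i x))).
  by rewrite -flip_cylinder.
exact: etrans (digits_law _ _) (esym (digits_law _ _)).
Qed.

Definition reindex (I : countType) (x : borel_config nat) : borel_config I :=
  fun i => x (choice.pickle i).

Lemma measurable_reindex (I : countType) : measurable_fun setT (@reindex I).
Proof. by apply: measurable_fun_config => i; exact: measurable_coord. Qed.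

HB.instance Definition _ (I : countType) :=
  isMeasurableFun.Build _ _ _ _ (@reindex I) (@measurable_reindex I).

(** The law of a family of independent fair bits indexed by I: coordinate i reads
    the binary digit of rank choice.pickle i of a uniform point of [0, 1). *)
Definition coin (I : countType) : probability (borel_config I) R :=
  distribution (distribution unit_lebesgue digits) (@reindex I).

Lemma coin_flip_invariant (I : countType) : flip_invariant (coin I).
Proof.
move=> i A mA; have mA' : measurable (@reindex I @^-1` A).
  by rewrite -[X in measurable X]setTI; exact: measurable_reindex.
have := digits_flip_invariant (choice.pickle i) mA'.
rewrite (_ : _ @^-1` _ = @reindex I @^-1` (flip i @^-1` A))//.
apply/seteqP; split=> x /=; congr A; apply/funext => j;
  by rewrite /reindex /flip (inj_eq (pcan_inj choice.pickleK)).
Qed.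

End CoinMeasure.
Arguments coin R I : clear implicits.

(** * Ergodicity, essential freeness and total non-freeness *)

(** The measure structure depends on the proof mf, which has to be given
    explicitly. *)
Definition image_measure d d' (T : measurableType d) (T' : measurableType d')
    (R : realFieldType) (m : {measure set T -> \bar R}) (f : T -> T')
    (mf : measurable_fun setT f) : {measure set T' -> \bar R} :=
  measure_function_pushforward__canonical__measure_function_Measure m mf.

Section CoinDynamics.
Context {R : realType} {I : countType}.
Local Notation mu := (coin R I).
Local Notation completion := (@completed_measure_extension _ _ _ mu).

(** A map that intertwines flips sends the coin measure to a flip-invariant
    probability measure, that is, to itself. *)
Lemma coin_preserved (f : borel_config I -> borel_config I) :
  measurable_fun setT f ->
  (forall i, exists j, forall x, f (flip j x) = flip i (f x)) ->
  forall A, measurable A -> mu (f @^-1` A) = mu A.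
Proof.
move=> mf comm A mA.
pose m := image_measure mu mf.
apply: (@flip_invariant_unique R I m mu) => //.
- move=> i B mB; have [j fj] := comm i.
  rewrite -[LHS]/(mu (f @^-1` (flip i @^-1` B))) -[RHS]/(mu (f @^-1` B)).
  rewrite -[RHS](coin_flip_invariant j).
    by congr (mu _); apply/seteqP; split=> x /=; rewrite fj.
  by rewrite -[X in measurable X]setTI; exact: (mf measurableT).
- exact: coin_flip_invariant.
- exact: le_lt_trans (probability_le1 mu measurableT) (ltry _).
Qed.

(** The restriction of the coin measure to a flip-invariant set A is
    flip-invariant, hence equal to mu A times the coin measure; evaluated on A,
    this gives mu A = mu A * mu A. *)
Lemma coin_zero_one (A : set (caratheodory_type (mu^*)%mu)) :
  measurable A -> (forall i, flip i @^-1` A = A) ->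
  completion A = 0%E \/ completion A = 1%E.
Proof.
move=> mA flipA.
have [B1 [B2 [mB1 mB2 B1A AB2 null]]] := (completion_measurableP A).1 mA.
(* Uniqueness is a statement on Borel sets, so both measures are compared there,
   at a Borel hull of A. *)
have midfun : measurable_fun setT (idfun : caratheodory_type (mu^*)%mu -> borel_config I).
  by move=> _ B mB; rewrite setTI; exact: measurable_completed.
pose m1 := image_measure (mrestr completion mA) midfun.
have Afin : completion A \is a fin_num by exact: fin_num_measure.
have A0 : 0 <= fine (completion A) by rewrite fine_ge0.
pose m2 : {measure set _ -> \bar R} := mscale (NngNum A0) mu.
have m12 : m1 B2 = m2 B2.
  apply: flip_invariant_unique => //.
  - move=> i B mB; rewrite -[LHS]/(completion (flip i @^-1` B `&` A)).
    rewrite -[RHS]/(completion (B `&` A)) -{1}(flipA i) -preimage_setI.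
    apply: (completed_measurable_fun _ _).2.
    + exact: measurable_flip.
    + exact: coin_flip_invariant.
    + by apply: measurableI => //; exact: measurable_completed.
  - by move=> i B mB; rewrite /m2/= /mscale; congr (_ * _)%E; exact: coin_flip_invariant.
  - rewrite -[LHS]/(completion (setT `&` A)) setTI.
    rewrite -[RHS]/((fine (completion A))%:E * mu setT)%E.
    by rewrite probability_setT mule1 fineK.
  - rewrite -[X in (X < _)%E]/(completion (setT `&` A)) setTI.
    by rewrite -ge0_fin_numE.
have B2A : mu B2 = completion A.
  rewrite -[LHS](completionE mu mB2) (completion_squeeze mB1 mB2 B1A AB2 null).
  by apply: completion_squeeze null => //; exact: subset_trans AB2.
have : completion A = (completion A * completion A)%E.
  move: m12; rewrite -[LHS]/(completion (B2 `&` A)) setIidr// => {1}->.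
  by rewrite -[LHS]/((fine (completion A))%:E * mu B2)%E fineK// B2A.
rewrite -(fineK Afin) -EFinM => -[]; set a := fine _ => aa.
have /eqP : a * (1 - a) = 0 by rewrite mulrBr mulr1 -aa subrr.
rewrite mulf_eq0 subr_eq0 => /orP[|] /eqP; first by move=> ->; left.
by move=> <-; right.
Qed.

End CoinDynamics.

Section EssentiallyFree.
Context {R : realType} {d : measure_display} {X : measurableType d}.
Variable mu : probability X R.

Lemma equimeasurable_disjoint_null (c : \bar R) (F : nat -> set X) :
  (forall n, measurable (F n)) -> trivIset setT F ->
  (forall n, mu (F n) = c) -> c = 0%E.
Proof.
move=> mF tF muF.
have c0 : (0 <= c)%E by rewrite -(muF 0%N).
have cfin : c \is a fin_num by rewrite -(muF 0%N) fin_num_measure.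
have le1 n : n%:R * fine c <= 1.
  rewrite -lee_fin EFinM fineK//.
  rewrite (_ : (n%:R%:E * c)%E = mu (\big[setU/set0]_(i < n) F i)).
    by apply: probability_le1; exact: bigsetU_measurable.
  rewrite measure_bigsetU// (eq_bigr (fun=> c)); last by move=> k _; exact: muF.
  by rewrite -(fineK cfin) sumEFin sumr_const card_ord -EFinM mulr_natl.
apply/eqP/negPn/negP => cn0.
have r0 : 0 < fine c by rewrite fine_gt0// lt0e cn0 c0 -ge0_fin_numE.
have := le1 (Num.truncn (fine c)^-1).+1.
by rewrite leNgt -ltr_pdivrMr// mul1r truncnS_gt.
Qed.

Context {G : groupType}.
Variable act : G -> X -> X.

(** The sets Fix (g ^ h n) all have the measure of Fix g.  If two distinct
    conjugates of g never fix the same point, then infinitely many of these sets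
    are disjoint, which forces Fix g to be null. *)
Lemma icc_essentially_free : icc G -> measure_preserving_action mu act ->
  (forall g, measurable (Fix act g)) ->
  (forall g h x, act g x = x -> act (g ^ h)%g x = x -> (g ^ h)%g = g) ->
  essentially_free mu act.
Proof.
move=> iccG [[act1 actM] mp] mFix sep g gn1; have [h hinj] := iccG _ gn1.
apply: (@equimeasurable_disjoint_null _ (fun n => Fix act (g ^ h n)%g)) => //.
  apply/trivIsetP => i j _ _ ij; apply/seteqP; split=> // x [/= xi xj].
  move: ij; rewrite -(inj_eq hinj) => /eqP; apply.
  have e : (g ^ h j = (g ^ h i) ^ ((h i)^-1 * h j))%g by rewrite conjgM conjgK.
  by apply/esym; rewrite /= e; apply: (sep _ _ x); rewrite -?e.
move=> n; rewrite -[RHS](mp (h n)).2//; congr (mu _); apply/seteqP; split=> x /=.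
  rewrite /Fix/conjg/= !actM => /(congr1 (act (h n))).
  by rewrite -(actM _ (h n)^-1%g) mulgV act1.
by rewrite /Fix/conjg/= !actM => ->; rewrite -actM mulVg act1.
Qed.

(** All Fix sets of an essentially free action have measure 0 or 1, and the sets
    of measure 0 or 1 form a sigma-algebra. *)
Lemma free_not_totally_non_free (A : set X) : essentially_free mu act ->
  mu (Fix act 1%g) = 1%E ->
  (forall g, measurable (Fix act g)) ->
  measurable A -> mu A <> 0%E -> mu A <> 1%E -> ~ totally_non_free mu act.
Proof.
move=> free F11 mF mA A0 A1 tnf.
pose S : set (set X) := [set B | measurable B /\ (mu B = 0%E \/ mu B = 1%E)].
suff : <<s range (Fix act) `|` [set N | measurable N /\ mu N = 0%E] >> `<=` S.
  by rewrite tnf => /(_ _ mA)[_ []].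
apply: smallest_sub; last first.
  move=> B [[g _ <-]|[mN N0]]; last by split=> //; left.
  split; first exact: mF.
  by have [->|/eqP/free g0] := eqVneq g 1%g; [right|left].
split.
- by split; [exact: measurable0|left; exact: measure0].
- move=> B [mB B01]; rewrite setTD; split; first exact: measurableC.
  rewrite probability_setC//.
  by case: B01 => ->; [right; rewrite sube0|left; rewrite subee].
- move=> F FS; have mF' k : measurable (F k) by case: (FS k).
  have mUF : measurable (\bigcup_k F k) by exact: bigcupT_measurable.
  split=> //; have [[k Fk]|nF] := pselect (exists k, mu (F k) = 1%E).
    right; apply/eqP; rewrite eq_le probability_le1//=.
    rewrite -Fk; apply: le_measure; rewrite ?inE//; exact: bigcup_sup.
  left; apply/eqP; rewrite -measure_le0.
  apply: le_trans (measure_sigma_subadditive mu mF' mUF _) _ => //.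
  rewrite eseries0// => k _ _; have [_ [//|Fk]] := FS k.
  by case: nF; exists k.
Qed.

End EssentiallyFree.

(** * The lamplighter group and its action *)

(** The wreath product of Z/2 by Z: the position of the lamplighter, and the
    finite set of the lamps that are lit. *)
Definition lamplighter : Type := (int * {fset int})%type.
HB.instance Definition _ := Countable.on lamplighter.

Section Lamplighter.
Implicit Types (A B : {fset int}) (k n m : int).

Definition symdiff A B := ((A `\` B) `|` (B `\` A))%fset.
Definition translate k A : {fset int} := [fset (i + k)%R | i in A]%fset.

Lemma in_symdiff A B i : (i \in symdiff A B) = (i \in A) (+) (i \in B).
Proof. by rewrite !inE; case: (i \in A); case: (i \in B). Qed.

Lemma in_translate k A i : (i \in translate k A) = ((i - k)%R \in A).
Proof.
apply/imfsetP/idP => [[j jA ->]|iA]; first by rewrite addrK.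
by exists (i - k)%R; rewrite ?subrK.
Qed.

Definition lamp_mul (g h : lamplighter) : lamplighter :=
  (g.1 + h.1, symdiff (translate g.1 h.2) g.2).
Definition lamp_one : lamplighter := (0, fset0).
Definition lamp_inv (g : lamplighter) : lamplighter :=
  (- g.1, translate (- g.1) g.2).

Lemma lamp_mulA : associative lamp_mul.
Proof.
move=> [k A] [m B] [n C]; congr pair; first exact: addrA.
apply/fsetP => i /=; rewrite !(in_symdiff, in_translate) addbA.
by rewrite opprD addrA.
Qed.

Lemma lamp_mul1g : left_id lamp_one lamp_mul.
Proof.
move=> [k A]; congr pair; first exact: add0r.
by apply/fsetP => i /=; rewrite !(in_symdiff, in_translate) in_fset0 addbF subr0.
Qed.

Lemma lamp_mulg1 : right_id lamp_one lamp_mul.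
Proof.
move=> [k A]; congr pair; first exact: addr0.
by apply/fsetP => i /=; rewrite !(in_symdiff, in_translate) in_fset0.
Qed.

Lemma lamp_mulVg : left_inverse lamp_one lamp_inv lamp_mul.
Proof.
move=> [k A]; congr pair; first exact: addNr.
by apply/fsetP => i /=; rewrite !(in_symdiff, in_translate) in_fset0 addbb.
Qed.

Lemma lamp_mulgV : right_inverse lamp_one lamp_inv lamp_mul.
Proof.
move=> [k A]; congr pair; first exact: addrN.
apply/fsetP => i /=; rewrite !(in_symdiff, in_translate) in_fset0 opprK subrK.
exact: addbb.
Qed.

HB.instance Definition _ := isGroup.Build lamplighter
  lamp_mulA lamp_mul1g lamp_mulg1 lamp_mulVg lamp_mulgV.

Lemma lamp_conjg1 (g h : lamplighter) : (g ^ h)%g.1 = g.1.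
Proof. by rewrite /= addrCA addNr addr0. Qed.

Lemma in_lamp_conjg (g h : lamplighter) i : (i \in (g ^ h)%g.2) =
  (i + h.1 - g.1 \in h.2) (+) (i + h.1 \in g.2) (+) (i + h.1 \in h.2).
Proof. by rewrite /= !(in_symdiff, in_translate) opprK. Qed.

(** If g moves the lamplighter, its conjugates by the elements that light the
    single lamp j are distinct.  If g only lights a finite nonempty set A of
    lamps, its conjugates are the translates of A; translations by multiples of a
    number larger than the diameter of A give distinct ones. *)
Lemma icc_lamplighter : icc lamplighter.
Proof.
move=> [k A] gn1; have [k0|kn0] := eqVneq k 0.
  have [A0|/fset0Pn[a aA]] := eqVneq A fset0; first by case: gn1; rewrite k0 A0.
  pose M := \max_(x <- A) `|x|%N.
  have AM x : x \in A -> (`|x| <= M)%N by move=> xA; exact: leq_bigmax_seq.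
  pose K := M.*2.+1.
  exists (fun j : nat => ((j * K)%:Z, fset0)) => i j /(congr1 snd)/fsetP e.
  have := e (a - (i * K)%:Z); rewrite !in_lamp_conjg !in_fset0 !addbF /= subrK aA.
  move=> /esym/AM; move: (AM _ aA); rewrite /K !PoszM.
  by move: (M) => m; nia.
exists (fun j : nat => (0, [fset (j%:Z : int)]%fset)) => i j /(congr1 snd)/fsetP e.
have := e j; have := e i; rewrite !in_lamp_conjg /= !in_fset1 !addr0 !eqxx.
case: (_ \in A); case: (_ \in A); lia.
Qed.

(** Affine transformation of the group of configurations: a shift followed by the
    addition of a finite configuration. *)
Definition lamp_act (g : lamplighter) (x : borel_config int) : borel_config int :=
  fun i => x (i - g.1) (+) (i \in g.2).

Lemma lamp_action : is_action lamp_act.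
Proof.
split=> [x|g h x]; apply/funext => i; rewrite /lamp_act /=.
  by rewrite subr0 in_fset0 addbF.
by rewrite in_symdiff in_translate addbA opprD addrA.
Qed.

Lemma lamp_act_flip g i x : lamp_act g (flip (i - g.1) x) = flip i (lamp_act g x).
Proof.
apply/funext => j; rewrite /lamp_act /flip addbAC.
by rewrite (inj_eq (addIr _)).
Qed.

Lemma lamp_act_single i : lamp_act (0, [fset i]%fset) = flip i.
Proof.
by apply/funext => x; apply/funext => j; rewrite /lamp_act /flip /= subr0 in_fset1.
Qed.

Lemma measurable_lamp_act g : measurable_fun setT (lamp_act g).
Proof.
apply: measurable_fun_config => i.
rewrite (_ : mkset _ = [set x : borel_config int | x (i - g.1) = (i \notin g.2)]).
  exact: measurable_coord.
by apply/seteqP; split=> x; rewrite /lamp_act/=; case: (x _); case: (i \in _).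
Qed.

(** Where g and h both fix x, each lamp set is the difference between x and the
    same shift of x. *)
Lemma lamp_act_separated (g h : lamplighter) x :
  lamp_act g x = x -> lamp_act h x = x -> g.1 = h.1 -> g = h.
Proof.
move=> gx hx gh1; rewrite [g]surjective_pairing [h]surjective_pairing gh1.
congr pair; apply/fsetP => i.
have := congr1 (@^~ i) gx; have := congr1 (@^~ i) hx.
rewrite /lamp_act gh1.
by case: (x _); case: (_ \in h.2); case: (_ \in g.2) => // <-.
Qed.

Lemma measurable_lamp_Fix g : measurable (Fix lamp_act g).
Proof. exact: measurable_fixpoints (measurable_lamp_act g). Qed.

End Lamplighter.

(** * An essentially free action with an indecomposable character *)

Theorem proposition27 (R : realType) :
  exists (G : groupType) (d : measure_display) (X : measurableType d)
         (mu : probability X R) (act : G -> X -> X),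
    [/\ countable [set: G],
        lebesgue_space mu,
        measure_preserving_action mu act,
        ergodic_action mu act &
        [/\ essentially_free mu act,
            ~ totally_non_free mu act &
            indecomposable (fix_character mu act)]].
Proof.
pose P := coin R int.
pose X : measurableType _ := caratheodory_type (P^*)%mu.
pose mu : probability X R := @completed_measure_extension _ _ _ P.
pose act : lamplighter -> X -> X := lamp_act.
have coinP g := coin_preserved (R := R) (measurable_lamp_act g)
  (fun i => ex_intro _ (i - g.1) (lamp_act_flip g i)).
have mpa : measure_preserving_action mu act.
  split=> [|g]; first exact: lamp_action.
  exact: completed_measurable_fun (measurable_lamp_act g) (coinP g).
have mFix g : measurable (Fix act g).
  by apply: measurable_completed; exact: measurable_lamp_Fix.
have Fix1 : Fix act 1%g = setT.
  by apply/seteqP; split=> // x _; exact: lamp_action.1.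
have free : essentially_free mu act.
  apply: icc_essentially_free => //; first exact: icc_lamplighter.
  move=> g h x gx ghx; apply: lamp_act_separated ghx gx _; exact: lamp_conjg1.
exists lamplighter, _, X, mu, act; split=> //.
- exact: countableP.
- exists (config int), idfun; split; first exact: config_polish.
    by exists idfun.
  exact: completion_measurableP.
- move=> A mA invA; apply: coin_zero_one => // i.
  by rewrite -lamp_act_single; exact: invA.
split=> //.
  (* Flipping the coordinate 0 exchanges A and its complement: mu A = 1 / 2. *)
  pose A : set X := [set x : borel_config int | x 0].
  have mA : measurable (A : set (borel_config int)) by exact: measurable_coord.
  have mA' : measurable (A : set X) by exact: measurable_completed.
  have muE (B : set (borel_config int)) : measurable B -> mu B = P B.
    exact: completionE.
  have halfA : mu A = (1 - mu A)%E.
    rewrite -probability_setC// (muE _ mA) (muE _ (measurableC mA)).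
    rewrite -(coin_flip_invariant 0)//; congr (P _).
    by apply/seteqP; split=> x /=; rewrite /A/flip/=; case: (x 0).
  apply: (free_not_totally_non_free free) mA' _ _ => //.
  - by rewrite Fix1 probability_setT.
  - by move=> A0; move: halfA; rewrite A0 sube0 => -[] /eqP; rewrite eq_sym oner_eq0.
  - by move=> A1; move: halfA; rewrite A1 subee// => -[] /eqP; rewrite oner_eq0.
suff -> : fix_character mu act = delta_character.
  exact/icc_indecomposable/icc_lamplighter.
apply/funext => g; rewrite /fix_character /delta_character.
have [->|/eqP gn1] := eqVneq g 1%g; first by rewrite Fix1 probability_setT.
by rewrite free.
Qed.
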